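(* Let $0 < a < 1$, let $I \subseteq [0,1)$ be a non-empty interval, and let $\kappa, c, \gamma \in \mathbb{R}$ with $c > 0$ and $\gamma \ne 0$. For Lebesgue-almost every $\alpha > 1$, the system \[ \left\| n a^{1/\alpha} + \frac{\kappa a^{1/\alpha}}{\alpha n^{\alpha-1}} \right\| \le \frac{c}{n^{\alpha-1}}, \qquad \{\gamma n^\alpha\} \in I \] has infinitely many solutions $n \in \mathbb{N}$ if $\alpha < 2$, and only finitely many solutions $n \in \mathbb{N}$ if $\alpha > 2$.
   Context: $\|x\|$ denotes the distance from $x$ to the nearest integer and $\{x\}$ the fractional part of $x$.
   Formalization: The interval I is assumed to have positive length (non-empty interior): for a one-point I and almost every α in (1,2) no n ≥ 2 satisfies {γn^α} ∈ I, so the claim of infinitely many solutions fails. *)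

(* Defs.v *)
From HB Require Import structures.
From mathcomp Require Export all_boot all_order all_algebra.
From mathcomp Require Export all_classical all_reals all_analysis.
Export Order.TTheory GRing.Theory Num.Theory.
Export numFieldNormedType.Exports.

Set Implicit Arguments.
Unset Strict Implicit.
Unset Printing Implicit Defensive.

Local Open Scope classical_set_scope.
Local Open Scope ring_scope.

Definition dist_int (R : realType) (x : R) : R :=
  inf [set `|x - k%:~R| | k in [set: int]].

Definition frac_part (R : realType) (x : R) : R := x - (Num.floor x)%:~R.

(* The restriction to 0 < n keeps the powers of n away from the convention
   that powR gives to 0 `^ p. *)
Definition solutions (R : realType) (a kappa c gamma : R) (I : set R)
    (alpha : R) : set nat :=
  [set n : nat | [/\ (0 < n)%N,
     dist_int (n%:R * a `^ (1 / alpha)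
               + kappa * a `^ (1 / alpha) / (alpha * n%:R `^ (alpha - 1)))
       <= c / n%:R `^ (alpha - 1)
   & I (frac_part (gamma * n%:R `^ alpha))]].

(* Main.v *)
Require Import Defs.
From mathcomp Require Import measurable_realfun ring lra zify.

(* Write h(x) = a^(1/x), a function that is bi-Lipschitz on compact subsets of
   [1, +oo[, so that the set of x for which n h(x) is within n^(1-x) of a given
   integer is an interval of length of order n^(-x).

   For alpha > 2, on [s, M] with s > 2, the solvable alpha for a given n are
   covered by O(n) balls of radius O(n^(-s)); their total length O(n^(1-s)) is
   summable and the Borel-Cantelli lemma applies.

   For alpha < 2 the argument is porosity: if every point x of A is such that,
   for some eta > 0 and for arbitrarily small r and large n, the ball of radius
   r around x contains a ball of radius eta r inside E_n, then by the Lebesgue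
   density theorem almost every point of A lies in infinitely many E_n.
   This is used twice.  First, Dirichlet's theorem gives n with
   |n h(alpha) - k| <= 1/n <= n^(1-alpha), hence at distance O(n^(-alpha)) of
   alpha there is an interval of comparable length on which the first condition
   holds with c/2 instead of c, so almost every alpha satisfies this condition
   infinitely often.  Secondly, around such an alpha the condition with c holds
   at scale n^(-alpha), whereas the phase gamma n^x has derivative of order
   n^alpha ln n: on the shorter scale n^(-alpha) / ln n it runs over a whole
   period and meets I modulo 1 on a positive proportion. *)

Local Open Scope classical_set_scope.
Local Open Scope ring_scope.


(** * Dirichlet approximation *)

Section Dirichlet.
Variable R : realType.

(** Pigeonhole: the fractional parts of [i * theta] for [0 <= i <= Q] fall into [Q] boxes of length
    [1 / Q], and two in the same box give [n] as the difference of their indices. *)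
Lemma Dirichlet_approximation (theta : R) (Q : nat) : (0 < Q)%N ->
  exists n : nat, exists k : int,
    [/\ (0 < n)%N, (n <= Q)%N & `|n%:R * theta - k%:~R| <= Q%:R^-1].
Proof.
case: Q => // Q _.
pose fr (i : nat) : R := i%:R * theta - (Num.floor (i%:R * theta))%:~R.
have fr_ge0 i : 0 <= fr i by rewrite subr_ge0 floor_le.
have fr_lt1 i : fr i < 1.
  by rewrite ltrBlDl addrC; have := floorD1_gt (i%:R * theta); rewrite intrD addrC.
have Q0 : 0 < Q.+1%:R :> R by rewrite ltr0n.
have box_lt i : (Num.truncn (Q.+1%:R * fr i) < Q.+1)%N.
  rewrite -(ltr_nat R); apply: le_lt_trans (_ : _ <= Q.+1%:R * fr i) _.
    by rewrite truncn_le ?mulr_ge0.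
  by rewrite gtr_pMr.
pose box (i : 'I_Q.+2) : 'I_Q.+1 := Ordinal (box_lt i).
have : ~~ injectiveb box.
  apply/injectiveP => /leq_card; by rewrite !card_ord ltnn.
case/injectivePn => i [j ij boxij].
wlog lt_ij : i j ij boxij / (i < j)%N.
  move=> H; have := ij; rewrite neq_ltn => /orP[|lt_ji]; first exact: H.
  by apply: (H j i) => //; rewrite eq_sym.
exists (j - i)%N, (Num.floor (j%:R * theta) - Num.floor (i%:R * theta)).
split; first by rewrite subn_gt0.
  by rewrite leq_subLR (leq_trans _ (leq_addl _ _)) // -ltnS.
have -> : (j - i)%N%:R * theta
    - (Num.floor (j%:R * theta) - Num.floor (i%:R * theta))%:~R = fr j - fr i.
  by rewrite natrB ?(ltnW lt_ij)// intrB /fr; ring.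
rewrite -[leRHS]mul1r ler_pdivlMr // mulrC -[X in X * _](gtr0_norm Q0) -normrM mulrBr.
have /(congr1 val)/= trij := boxij.
have /andP[] := truncn_itv (mulr_ge0 (ltW Q0) (fr_ge0 i)).
have /andP[] := truncn_itv (mulr_ge0 (ltW Q0) (fr_ge0 j)).
rewrite trij -natr1 => *; rewrite ler_norml; lra.
Qed.

(** Since [n] and [k] may have a common factor, multiples of a good denominator cover rational
    [theta] as well. *)
Lemma Dirichlet_infinitely_often (theta : R) (N : nat) :
  exists n : nat, exists k : int,
    [/\ (0 < n)%N, (N <= n)%N & `|n%:R * theta - k%:~R| <= n%:R^-1].
Proof.
wlog N0 : N / (0 < N)%N.
  move=> H; have [n [k [n0 Nn ?]]] := H N.+1 isT.
  by exists n, k; split => //; exact: ltnW.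
(* If the denominator n found below N ^ 3 is smaller than N, then N * n is in
   [N, N ^ 2] and the error is multiplied by N only. *)
have N3 : (0 < N ^ 3)%N by rewrite expn_gt0 N0.
have [n [k [n0 nQ nk]]] := Dirichlet_approximation theta _ N3.
have [Nn|nN] := leqP N n.
  exists n, k; split => //; apply: le_trans nk _.
  by rewrite lef_pV2 ?posrE ?ltr0n// ler_nat.
exists (N * n)%N, (N%:Z * k).
split; [by rewrite muln_gt0 N0|by rewrite leq_pmulr|].
rewrite natrM intrM -mulrA -mulrBr normrM ger0_norm ?ler0n //.
apply: le_trans (_ : _ <= N%:R * (N ^ 3)%:R^-1) _.
  by rewrite ler_wpM2l ?ler0n.
rewrite natrX exprS invfM mulrA mulfV ?pnatr_eq0 -?lt0n // mul1r.
rewrite lef_pV2 ?posrE ?exprn_gt0 ?mulr_gt0 ?ltr0n //.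
by rewrite expr2 ler_wpM2l ?ler0n// ler_nat ltnW.
Qed.

End Dirichlet.

(** * Porosity *)

Section Porosity.
Variable R : realType.
Local Notation mu := (@lebesgue_measure R).

(** On the balls given by porosity, the complement of [U] fills a proportion at most [1 - eta],
    whereas almost every point of this complement has density 1 in it. *)
Lemma porous_negligible (A U : set R) : open U ->
  (forall x, A x -> exists2 eta : R, 0 < eta & forall eps : R, 0 < eps ->
     exists r y : R, [/\ 0 < r, r < eps, ball y (eta * r) `<=` U
                         & ball y (eta * r) `<=` ball x r]) ->
  mu.-negligible (A `\` U).
Proof.
move=> oU porA.
have mU : measurable (~` U) by apply: measurableC; exact: open_measurable.
have := lebesgue_density mU; apply: negligibleS => x /= [Ax nUx] cvx.
have [eta eta0 por] := porA _ Ax.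
rewrite indicE mem_set // in cvx.
have : \forall r \near 0^'+, 
    ((1 - eta)%:E < mu (~` U `&` ball x r) * (mu (ball x r))^-1)%E.
  have : nbhs (1%:E : \bar R) [set z | ((1 - eta)%:E < z)%E].
    apply: open_nbhs_nbhs; split; last by rewrite /= lte_fin; lra.
    exact: open_ereal_gt_ereal.
  exact: cvx.
case=> d /= d0 Hd.
have [r [y [r0 rd yU yx]]] := por d d0.
have : ball (0:R) d r by rewrite /ball /= sub0r normrN gtr0_norm.
move=> /Hd /(_ r0); apply/negP; rewrite -leNgt.
have er0 : 0 <= eta * r by rewrite mulr_ge0 ?ltW.
have mB z s : measurable (ball (z : R) s) by exact: measurable_ball.
have : (mu (~` U `&` ball x r) + mu (ball y (eta * r)) <= mu (ball x r))%E.
  have mUB : measurable (~` U `&` ball x r).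
    by apply: measurableI => //; exact: mB.
  rewrite -measureU//; first last.
  - by rewrite -subset0 => z [[nUz _] /yU].
  - exact: mB.
  - apply: le_measure; rewrite ?inE.
    + by apply: measurableU => //; exact: mB.
    + exact: mB.
    + by rewrite subUset; split => // z [].
rewrite !lebesgue_measure_ball// ?(ltW r0)//.
have rr0 : r *+ 2 != 0 by rewrite mulrn_eq0/= gt_eqF.
have [bx0 bxE] : mu (ball x r) != 0 /\ mu (ball x r) = (r *+ 2)%:E.
  by rewrite lebesgue_measure_ball ?(ltW r0)// eqe.
have fin : mu (~` U `&` ball x r) \is a fin_num.
  rewrite ge0_fin_numE//; apply: (@le_lt_trans _ _ (mu (ball x r))) => [|].
    apply: le_measure; rewrite ?inE//; last exact: mB.
    by apply: measurableI => //; exact: mB.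
  by rewrite bxE ltry.
rewrite -(fineK fin) inver (negbTE rr0) -EFinD -EFinM !lee_fin.
move: (fine _) => m H; rewrite ler_pdivrMr ?mulrn_wgt0//.
by move: H; rewrite mulrBl mul1r mulrnAr lerBrDr.
Qed.

(** A point outside the limsup misses the interior [U N] of some tail union. As [n] can be taken
    beyond any [N], porosity applies to each [U N], which leaves a countable union of null sets. *)
Lemma porous_limsup_negligible (A : set R) (E : nat -> set R) :
  (forall x, A x -> exists2 eta : R, 0 < eta & forall (eps : R) (N : nat), 0 < eps ->
     exists n r y, [/\ (N <= n)%N, 0 < r < eps, ball y (eta * r) `<=` E n
                         & ball y (eta * r) `<=` ball x r]) ->
  mu.-negligible (A `\` lim_sup_set E).
Proof.
move=> por; pose U N := interior (\bigcup_(n >= N) E n).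
suff: mu.-negligible (\bigcup_N (A `\` U N)).
  apply: negligibleS; move=> x [Ax nEx]; apply: contrapT => H; apply: nEx => N _.
  apply: interior_subset; apply: contrapT => nU; apply: H; by exists N.
apply: negligible_bigcup => N; apply: porous_negligible.
  exact: open_interior.
move=> x /por [eta eta0 H]; exists eta => // eps /(H eps N).
move=> [n [r [y [Nn /andP[r0 re] yE yx]]]]; exists r, y; split => //.
apply: (subset_trans _ (_ : (ball y (eta * r))° `<=` _)).
  by move=> z yz; apply: open_nbhs_nbhs; split => //; exact: ball_open.
by apply: interiorS => z /yE Ez; exists n.
Qed.

End Porosity.


(** * Estimates on [a `^ (1 / x)] *)

Section Estimates.
Variables (R : realType) (a kappa : R).
Hypotheses (a_gt0 : 0 < a) (a_lt1 : a < 1).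

Let ln_a_lt0 : ln a < 0. Proof. by apply: ln_lt0; rewrite a_gt0. Qed.

Lemma powR_invE x : a `^ (1 / x) = expR (ln a / x).
Proof. by rewrite /powR gt_eqF// mulrC mulrA mulr1. Qed.

Lemma powR_inv_le1 x : 0 < x -> a `^ (1 / x) <= 1.
Proof.
move=> x0; rewrite powR_invE expR_le1 -oppr_ge0 -mulNr.
by rewrite divr_ge0 ?ltW// oppr_gt0.
Qed.

Lemma powR_inv_gea x : 1 <= x -> a <= a `^ (1 / x).
Proof.
move=> x1; apply: ger1_powR; first by rewrite a_gt0 ltW.
by rewrite div1r invf_le1// (lt_le_trans ltr01).
Qed.

(** With [d = 1/x - 1/y], [a^(1/x) = a^(1/y) * expR (ln a * d)]; then use [expR t >= 1 + t],
    [a^(1/y) <= 1] and [d <= y - x]. *)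
Lemma powR_inv_increment x y : 1 <= x -> x <= y ->
  a `^ (1 / y) - a `^ (1 / x) <= - ln a * (y - x).
Proof.
move=> x1 xy; have x0 : 0 < x by lra.
have y0 : 0 < y by lra.
have le_t : - ln a * (x^-1 - y^-1) <= - ln a * (y - x).
  rewrite ler_wpM2l ?oppr_ge0 ?(ltW ln_a_lt0)//.
  have -> : x^-1 - y^-1 = (y - x) / (x * y) by field; rewrite !gt_eqF.
  rewrite ler_pdivrMr ?mulr_gt0// ler_peMr ?subr_ge0//; nra.
apply: le_trans le_t; rewrite !powR_invE.
have -> : ln a / x = ln a / y + ln a * (x^-1 - y^-1) by ring.
rewrite expRD; have := expR_ge1Dx (ln a * (x^-1 - y^-1)).
have ey1 : expR (ln a / y) <= 1 by rewrite -powR_invE powR_inv_le1.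
have := expR_gt0 (ln a / y).
have : x^-1 - y^-1 >= 0 by rewrite subr_ge0 lef_pV2.
set e := expR _ in ey1 *; set d := _ - _; set e' := expR _.
have : ln a < 0 by [].
set l := ln a; move=> l0 d0 e0 de.
have : 0 <= (1 - e) * (- l * d) by rewrite mulr_ge0 ?mulr_ge0//; lra.
have : e * (1 + l * d) <= e * e' by rewrite ler_wpM2l// ltW.
lra.
Qed.

Lemma powR_inv_lipschitz x y : 1 <= x -> 1 <= y ->
  `|a `^ (1 / y) - a `^ (1 / x)| <= - ln a * `|y - x|.
Proof.
wlog xy : x y / x <= y.
  move=> H x1 y1; have [/H|/ltW yx] := leP x y; first exact.
  by rewrite distrC (distrC y) H.
move=> x1 y1; have x0 : 0 < x by lra.
rewrite !ger0_norm ?subr_ge0//; first exact: powR_inv_increment.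
apply: ger_powR; first by rewrite a_gt0 ltW.
by rewrite !div1r lef_pV2 ?posrE// (lt_le_trans x0).
Qed.

(** Factor out [a^(1/x) >= a] and use [1/x - 1/y >= (y - x) / M^2]. This lower slope serves both to
    reach a prescribed value close to a point and to bound the length of solution sets. *)
Lemma powR_inv_increment_ge M x y : 1 <= x -> x <= y -> y <= M ->
  a * - ln a / M ^+ 2 * (y - x) <= a `^ (1 / y) - a `^ (1 / x).
Proof.
move=> x1 xy yM; have x0 : 0 < x by lra.
have y0 : 0 < y by lra.
have M0 : 0 < M by lra.
have -> : a `^ (1 / y) = a `^ (1 / x) * expR (- ln a * (x^-1 - y^-1)).
  by rewrite !powR_invE -expRD; congr expR; ring.
have ax := powR_inv_gea _ x1.
have d0 : (y - x) / M ^+ 2 <= x^-1 - y^-1.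
  have -> : x^-1 - y^-1 = (y - x) / (x * y) by field; rewrite !gt_eqF.
  rewrite ler_wpM2l ?subr_ge0// lef_pV2 ?posrE ?exprn_gt0 ?mulr_gt0//.
  by rewrite expr2 ler_pM//; lra.
have d00 : 0 <= (y - x) / M ^+ 2.
  by rewrite divr_ge0 ?subr_ge0 ?exprn_ge0// ltW.
have -> : a * - ln a / M ^+ 2 * (y - x) = a * - ln a * ((y - x) / M ^+ 2) by ring.
rewrite -[X in _ <= _ - X]mulr1 -mulrBr -mulrA.
have l0 : 0 <= - ln a by rewrite oppr_ge0 ltW.
apply: ler_pM => //; first exact: ltW.
  by rewrite mulr_ge0.
rewrite lerBrDl; apply: le_trans (expR_ge1Dx _).
by rewrite lerD2l ler_wpM2l.
Qed.

Lemma continuous_powR_inv (x : R) : 0 < x ->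
  {for x, continuous (fun x : R => a `^ (1 / x))}.
Proof.
move=> x0; rewrite (_ : (fun _ => _) = (fun x : R => expR (ln a / x))); last first.
  by apply/funext => y; rewrite powR_invE.
apply: (@cvg_comp _ _ _ (fun x : R => ln a / x) (@expR R)); last exact: continuous_expR.
by apply: cvgM; [exact: cvg_cst|apply: cvgV; rewrite ?gt_eqF//; exact: cvg_id].
Qed.

(** The perturbation in the first condition; it is at most of the order [n^(1-x)] of the
    tolerance. *)
Definition shift (n : nat) (x : R) := kappa * a `^ (1 / x) / (x * n%:R `^ (x - 1)).

Lemma shiftE n x : shift n x = kappa * a `^ (1 / x) / x * n%:R `^ (1 - x).
Proof. by rewrite /shift invfM mulrA -powRN opprB. Qed.

Lemma natr_powR_le_inv (n : nat) (x : R) : (0 < n)%N -> 1 <= x ->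
  n%:R `^ (- x) <= n%:R^-1.
Proof.
move=> n0 x1; rewrite -powR_inv1 ?ler0n// ler_powR ?ler1n//; lra.
Qed.

Lemma norm_shift_le n x : 1 <= x -> `|shift n x| <= `|kappa| * n%:R `^ (1 - x).
Proof.
move=> x1; have x0 : 0 < x by lra.
rewrite shiftE normrM (ger0_norm (powR_ge0 _ (1 - x))) ler_wpM2r ?powR_ge0//.
rewrite -mulrA normrM ler_piMr// ger0_norm; last first.
  by rewrite divr_ge0 ?powR_ge0 ?(ltW x0).
by rewrite ler_pdivrMr// [leRHS]mul1r (le_trans (powR_inv_le1 _ x0)).
Qed.

Lemma near_natr_powRN (alpha C e : R) : 1 < alpha -> 0 < e ->
  \forall n \near \oo, C * n%:R `^ (- alpha) <= e.
Proof.
move=> alpha1 e0; near=> n.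
have n0 : (0 < n)%N by near: n; exact: nbhs_infty_gt.
have := natr_powR_le_inv _ _ n0 (ltW alpha1).
have n0' : 0 < n%:R :> R by rewrite ltr0n.
have : `|C| / e <= n%:R by near: n; exact: nbhs_infty_ger.
rewrite ler_pdivrMr// => Cn ninv.
have := ler_norm (C * n%:R `^ (- alpha)).
rewrite normrM (ger0_norm (powR_ge0 _ _)) => /le_trans; apply.
apply: le_trans (_ : `|C| / n%:R <= _); first by rewrite ler_wpM2l.
by rewrite ler_pdivrMr// mulrC.
Unshelve. all: by end_near. Qed.

(** Half of the excess [alpha - 1] of the exponent absorbs the logarithm. *)
Lemma near_natr_powRN_ln (alpha C e : R) : 1 < alpha -> 0 < e ->
  \forall n \near \oo, C * n%:R `^ (- alpha) * ln n%:R <= e.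
Proof.
move=> alpha1 e0.
pose s := (alpha + 1) / 2.
have s1 : 1 < s by rewrite /s; lra.
have t0 : 0 < (alpha - 1) / 2 by lra.
near=> n.
have n0 : (0 < n)%N by near: n; exact: nbhs_infty_gt.
have n0' : 0 < n%:R :> R by rewrite ltr0n.
have -> : - alpha = - s - (alpha - 1) / 2 by rewrite /s; field.
have lnn : ln n%:R <= n%:R `^ ((alpha - 1) / 2) / ((alpha - 1) / 2).
  rewrite ler_pdivlMr// mulrC -ln_powR.
  by rewrite ltW// ln_sublinear// powR_gt0.
have ln0 : 0 <= ln (n%:R : R) by rewrite ln_ge0// ler1n.
have small : `|C| / ((alpha - 1) / 2) * n%:R `^ (- s) <= e.
  by near: n; exact: near_natr_powRN.
apply: le_trans small.
rewrite powRB; last by rewrite (gt_eqF n0')/= implybT.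
apply: le_trans (_ : `|C| * (n%:R `^ (- s) / n%:R `^ ((alpha - 1) / 2)) * ln n%:R <= _).
  rewrite ler_wpM2r// ler_wpM2r ?ler_norm// divr_ge0 ?powR_ge0//.
rewrite -!mulrA ler_wpM2l// [leRHS]mulrC ler_wpM2l ?powR_ge0//.
by rewrite ler_pdivrMl ?powR_gt0.
Unshelve. all: by end_near. Qed.

End Estimates.


(** * Infinitely many solutions *)

Section Targets.
Variables (R : realType) (a kappa : R).
Hypotheses (a_gt0 : 0 < a) (a_lt1 : a < 1).
Local Notation shift := (shift R a kappa).

(** For such [x], [(alpha - x) * ln n] tends to 0, so [n^(1-x) / n^(1-alpha)] tends to 1; the shift
    is this power times a continuous function. Both may thus be treated as frozen at [alpha]. *)
Lemma near_shift (alpha C e : R) : 1 < alpha -> 0 < e ->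
  \forall n \near \oo, forall x : R, `|x - alpha| <= C * n%:R `^ (- alpha) ->
    `|n%:R `^ (1 - x) - n%:R `^ (1 - alpha)| <= e * n%:R `^ (1 - alpha) /\
    `|shift n x - shift n alpha| <= e * n%:R `^ (1 - alpha).
Proof.
move=> alpha1 e0; have alpha0 : 0 < alpha by lra.
pose phi (x : R) := kappa * a `^ (1 / x) / x.
have phi_cont : {for alpha, continuous phi}.
  apply: cvgM; last by apply: cvgV; rewrite ?gt_eqF//; exact: cvg_id.
  by apply: cvgMr; exact: continuous_powR_inv.
(* [d <= 1] gives [|E| <= 2], and the two error terms add up to at most
   [d * (2 + |phi alpha|) <= e]. *)
pose d := Num.min 1 (e / (2 + `|phi alpha|)).
have phi2_gt0 : 0 < 2 + `|phi alpha| by rewrite ltr_pwDl.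
have d0 : 0 < d by rewrite lt_min ltr01 divr_gt0.
have d1 : d <= 1 by rewrite ge_min lexx.
have de : d * (2 + `|phi alpha|) <= e.
  by rewrite -ler_pdivlMr// ge_min lexx orbT.
have /cvgrPdist_le /(_ d d0) [r /= r0 phir] := phi_cont.
have /cvgrPdist_le /(_ d d0) [s /= s0 exps] := @continuous_expR R 0.
near=> n => x xalpha.
have n0 : (0 < n)%N by near: n; exact: nbhs_infty_gt.
have n0' : 0 < n%:R :> R by rewrite ltr0n.
have ln0 : 0 <= ln (n%:R : R) by rewrite ln_ge0// ler1n.
have Cr : C * n%:R `^ (- alpha) <= r / 2.
  by near: n; apply: near_natr_powRN => //; rewrite divr_gt0.
have Cs : C * n%:R `^ (- alpha) * ln n%:R <= s / 2.
  by near: n; apply: near_natr_powRN_ln => //; rewrite divr_gt0.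
have phix : `|phi x - phi alpha| <= d.
  rewrite distrC; apply: phir; rewrite /= distrC.
  by apply: le_lt_trans xalpha _; apply: le_lt_trans Cr _; lra.
pose E := expR ((alpha - x) * ln n%:R).
have Ed : `|E - 1| <= d.
  rewrite distrC -(expR0 R); apply: exps; rewrite /= sub0r normrN normrM.
  rewrite distrC (ger0_norm ln0); apply: (@le_lt_trans _ _ (s / 2)); last by lra.
  by apply: le_trans Cs; rewrite ler_wpM2r.
have nE : n%:R `^ (1 - x) = n%:R `^ (1 - alpha) * E.
  rewrite {1}/powR [in RHS]/powR (gt_eqF n0') -expRD; congr expR; ring.
have n1 : 0 <= n%:R `^ (1 - alpha) by exact: powR_ge0.
have dphi : 0 <= d * `|phi alpha| by rewrite mulr_ge0// ltW.
split.
  rewrite nE -[X in _ - X]mulr1 -mulrBr normrM (ger0_norm n1) mulrC ler_wpM2r//.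
  apply: le_trans Ed _; lra.
rewrite !shiftE -!/(phi _) nE.
have -> : phi x * (n%:R `^ (1 - alpha) * E) - phi alpha * n%:R `^ (1 - alpha) =
  ((phi x - phi alpha) * E + phi alpha * (E - 1)) * n%:R `^ (1 - alpha) by ring.
rewrite normrM (ger0_norm n1) ler_wpM2r//.
apply: le_trans (ler_normD _ _) _.
rewrite (normrM (phi x - _)) (normrM (phi alpha)).
have E0 : 0 <= E by rewrite expR_ge0.
have E2 : `|E| <= 2.
  by rewrite ger0_norm//; move: Ed; rewrite ler_norml => /andP[_]; lra.
apply: le_trans de; rewrite mulrDr lerD//; first by rewrite ler_pM.
by rewrite mulrC ler_wpM2r.
Unshelve. all: by end_near. Qed.

(** The first condition with an explicit integer [k], which can be kept fixed while [x] moves. *)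
Definition near_integer (c : R) (n : nat) : set R :=
  [set x | [/\ (0 < n)%N, 1 < x & exists k : int,
     `|n%:R * a `^ (1 / x) + shift n x - k%:~R| <= c * n%:R `^ (1 - x)]].

Lemma mulr_natr_powRN (n : nat) (x : R) : (0 < n)%N ->
  n%:R * n%:R `^ (- x) = n%:R `^ (1 - x) :> R.
Proof.
move=> n0; rewrite powRD; last by rewrite pnatr_eq0 -lt0n n0 implybT.
by rewrite powRr1.
Qed.

(** Moving [alpha] by at most [B * n^(-alpha)] reaches a point [y] where the integer is hit exactly,
    up to the variation of the shift; the condition then persists on a ball of comparable radius
    around [y]. *)
Lemma near_integer_porous (alpha c : R) : 0 < c -> 1 < alpha -> alpha < 2 ->
  exists2 eta : R, 0 < eta & forall (eps : R) (N : nat), 0 < eps ->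
    exists n r y, [/\ (N <= n)%N, 0 < r < eps,
      ball y (eta * r) `<=` near_integer c n & ball y (eta * r) `<=` ball alpha r].
Proof.
move=> c0 alpha1 alpha2.
have L0 : 0 < - ln a by rewrite oppr_gt0 ln_lt0// a_gt0.
(* [m] is the lower slope on [[1, 3]], [B] converts the error [1 + |kappa|] into a displacement, and
   [rho] limits the Lipschitz error to [c / 8] times [n^(1-alpha)]. *)
pose m := a * - ln a / 3 ^+ 2; have m0 : 0 < m by rewrite !mulr_gt0// invr_gt0 exprn_gt0.
pose B := (1 + `|kappa|) / m; have B0 : 0 < B by rewrite divr_gt0// ltr_pwDl.
pose rho := c / (8 * - ln a); have rho0 : 0 < rho by rewrite divr_gt0// mulr_gt0.
have Brho : 0 < B + 2 * rho by lra.
exists (rho / (B + 2 * rho)); first by rewrite divr_gt0.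
move=> eps N eps0.
(* Budget: [c / 8] for the main term and [c / 8] for the shift, against a tolerance that keeps at
   least half of [c * n^(1-alpha)]. *)
have [M _ HM] : \forall n \near \oo,
    [/\ (B + 2 * rho) * n%:R `^ (- alpha) < eps,
        (B + 2 * rho) * n%:R `^ (- alpha) < alpha - 1,
        (B + 2 * rho) * n%:R `^ (- alpha) < 1 &
        forall x, `|x - alpha| <= (B + 2 * rho) * n%:R `^ (- alpha) ->
        `|n%:R `^ (1 - x) - n%:R `^ (1 - alpha)|
          <= Num.min (c / 8) (1 / 2) * n%:R `^ (1 - alpha) /\
        `|shift n x - shift n alpha|
          <= Num.min (c / 8) (1 / 2) * n%:R `^ (1 - alpha)].
  have lt_near e : 0 < e ->
      \forall n \near \oo, (B + 2 * rho) * n%:R `^ (- alpha) < e.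
    move=> e0; have e2 : 0 < e / 2 by lra.
    have := near_natr_powRN _ _ (B + 2 * rho) (e / 2) alpha1 e2.
    by apply: filterS => n /le_lt_trans; apply; lra.
  near=> n; split; [near: n..|].
  - exact: lt_near.
  - by apply: lt_near; lra.
  - exact: lt_near.
  - near: n; apply: near_shift => //.
    by rewrite lt_min !divr_gt0.
have [n [k [n0 Nn nk]]] := Dirichlet_infinitely_often _ (a `^ (1 / alpha)) (maxn M N).
move: Nn; rewrite geq_max => /andP[Mn Nn].
have [req ralpha r1 near_n] := HM n Mn.
have n0' : 0 < n%:R :> R by rewrite ltr0n.
set s := n%:R `^ (- alpha) in req ralpha r1 near_n *.
have s0 : 0 < s by rewrite powR_gt0.
have nsE : n%:R `^ (1 - alpha) = n%:R * s by rewrite mulr_natr_powRN.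
have Bs0 : 0 < B * s by rewrite mulr_gt0.
have rhos0 : 0 < rho * s by rewrite mulr_gt0.
have rE : (B + 2 * rho) * s = B * s + 2 * (rho * s) by rewrite mulrDl mulrA.
rewrite rE in req ralpha r1 near_n.
have lo1 : 1 < alpha - B * s by move: ralpha rhos0; clear - a_gt0 a_lt1; lra.
have hi3 : alpha + B * s < 3 by move: alpha2 r1 rhos0; clear - a_gt0 a_lt1; lra.
have lex : alpha <= alpha + B * s by rewrite lerDl ltW.
have ley : alpha - B * s <= alpha by rewrite gerBl ltW.
have nk' : `|n%:R * a `^ (1 / alpha) + shift n alpha - k%:~R|
    <= (1 + `|kappa|) * (n%:R * s).
  rewrite addrAC; apply: le_trans (ler_normD _ _) _.
  rewrite [leRHS]mulrDl [X in _ <= X + _]mul1r -nsE; apply: lerD; last first.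
    by apply: norm_shift_le => //; exact: ltW.
  apply: le_trans nk _; rewrite -powR_inv1 ?ler0n//.
  by apply: ler_powR; [rewrite ler1n|move: alpha2; clear - a_gt0 a_lt1; lra].
(* The shift is frozen at alpha, so that the center y is a solution of
   a `^ (1 / y) = v; near_shift controls its variation. *)
pose v := (k%:~R - shift n alpha) / n%:R.
have vE : n%:R * v = k%:~R - shift n alpha.
  by rewrite /v mulrC divfK// gt_eqF.
have : `|a `^ (1 / alpha) - v| <= m * (B * s).
  rewrite mulrA (_ : m * B = 1 + `|kappa|); last first.
    by rewrite /B mulrC divfK// gt_eqF.
  rewrite -(ler_pM2l n0') -[X in X * `|_|](gtr0_norm n0') -normrM mulrBr vE.
  by rewrite opprB addrA addrAC mulrCA (addrAC (n%:R * _)).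
rewrite ler_norml => /andP[vle vge].
have up := powR_inv_increment_ge _ _ a_gt0 a_lt1 3 alpha (alpha + B * s).
have lo := powR_inv_increment_ge _ _ a_gt0 a_lt1 3 (alpha - B * s) alpha.
have {}up : m * (B * s) <= a `^ (1 / (alpha + B * s)) - a `^ (1 / alpha).
  have := up (ltW alpha1) lex (ltW hi3).
  by rewrite (_ : alpha + B * s - alpha = B * s) //; ring.
have {}lo : m * (B * s) <= a `^ (1 / alpha) - a `^ (1 / (alpha - B * s)).
  have := lo (ltW lo1) ley (le_trans lex (ltW hi3)).
  by rewrite (_ : alpha - (alpha - B * s) = B * s) //; ring.
(* The increments over [B * s] on either side of [alpha] exceed the distance from [a^(1/alpha)] to
   [v]. *)
have [y] : exists2 y, y \in `[alpha - B * s, alpha + B * s] & a `^ (1 / y) = v.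
  apply: (@IVT _ (fun y => a `^ (1 / y))); first exact: le_trans ley lex.
    apply: continuous_in_subspaceT => y; rewrite inE/= in_itv/= => /andP[y1 _].
    by apply: continuous_powR_inv => //; move: y1 lo1; clear - a_gt0 a_lt1; lra.
  by rewrite ge_min le_max; apply/andP; split; apply/orP; [left|right];
    move: up lo vle vge; clear - a_gt0 a_lt1; lra.
rewrite in_itv/= => /andP[y1 y2] hy.
exists n, ((B + 2 * rho) * s), y.
have -> : rho / (B + 2 * rho) * ((B + 2 * rho) * s) = rho * s.
  by field; rewrite gt_eqF.
have near_y z : ball y (rho * s) z -> `|z - alpha| < B * s + rho * s.
  rewrite /ball/= => yz.
  rewrite (_ : z - alpha = (z - y) + (y - alpha)); last by ring.
  apply: le_lt_trans (ler_normD _ _) _; rewrite addrC ler_ltD 1?distrC//.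
  by rewrite distrC ler_norml; move: y1 y2; clear - a_gt0 a_lt1 => *; apply/andP; split; lra.
split => //.
- by rewrite mulr_gt0//= rE.
- move=> z yz; have za := near_y _ yz.
  have zle : `|z - alpha| <= B * s + 2 * (rho * s).
    apply: le_trans (ltW za) _; rewrite lerD2l.
    by move: rhos0; clear - a_gt0 a_lt1; lra.
  have [nz sz] := near_n z zle.
  move: (za); rewrite ltr_norml => /andP[z1 z2].
  split => //; first by move: z1 ralpha rhos0; clear - a_gt0 a_lt1; lra.
  exists k.
  have minle8 : Num.min (c / 8) (1 / 2) * n%:R `^ (1 - alpha) <= c / 8 * (n%:R * s).
    by rewrite nsE ler_wpM2r ?ge_min ?lexx// mulr_ge0 ?ltW.
  have minle2 : Num.min (c / 8) (1 / 2) * n%:R `^ (1 - alpha) <= 1 / 2 * (n%:R * s).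
    by rewrite nsE ler_wpM2r ?ge_min ?lexx ?orbT// mulr_ge0 ?ltW.
  have lip : `|a `^ (1 / z) - a `^ (1 / y)| <= - ln a * (rho * s).
    apply: le_trans (powR_inv_lipschitz _ _ a_gt0 a_lt1 _ _ _ _) _.
    - by move: y1 lo1; clear - a_gt0 a_lt1; lra.
    - by move: z1 ralpha rhos0; clear - a_gt0 a_lt1; lra.
    by rewrite ler_pM2l// distrC ltW.
  have -> : n%:R * a `^ (1 / z) + shift n z - k%:~R =
     n%:R * (a `^ (1 / z) - a `^ (1 / y)) + (shift n z - shift n alpha).
    by rewrite mulrBr hy vE; ring.
  apply: le_trans (ler_normD _ _) _.
  rewrite normrM (gtr0_norm n0').
  have lip' : n%:R * `|a `^ (1 / z) - a `^ (1 / y)| <= c / 8 * (n%:R * s).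
    apply: le_trans (_ : n%:R * (- ln a * (rho * s)) <= _); first by rewrite ler_pM2l.
    rewrite le_eqVlt; apply/orP; left; apply/eqP; rewrite /rho; field.
    by rewrite -oppr_eq0 gt_eqF.
  have : 1 / 2 * (n%:R * s) <= n%:R `^ (1 - z).
    by move: (le_trans nz minle2); rewrite nsE ler_norml => /andP[]; clear - a_gt0 a_lt1; lra.
  move=> /(ler_wpM2l (ltW c0)); apply: le_trans.
  have : 0 <= c * (n%:R * s) by rewrite !mulr_ge0 ?ltW.
  by move: lip' (le_trans sz minle8); clear - a_gt0 a_lt1; lra.
- move=> z /near_y; rewrite /ball/= distrC => /lt_trans; apply.
  by rewrite rE ltrD2l; move: rhos0; clear - a_gt0 a_lt1; lra.
Unshelve. all: by end_near. Qed.

End Targets.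


(** * Distance to the integers, fractional parts and phase windows *)

Lemma dist_int_le (R : realType) (x : R) (k : int) : dist_int x <= `|x - k%:~R|.
Proof. by apply: ge_inf; [exists 0 => _ [j _ <-]|exists k]. Qed.

Lemma dist_int_lt (R : realType) (x d : R) : dist_int x < d ->
  exists k : int, `|x - k%:~R| < d.
Proof.
move=> xd; have [||_ [k _ <-]] := @inf_adherent R [set `|x - k%:~R| | k in [set: int]] (d - dist_int x).
- by rewrite subr_gt0.
- by split; [exists `|x - 0%:~R|, 0|exists 0 => _ [j _ <-]].
by move=> xk; exists k; rewrite /dist_int [ltRHS]addrC subrK in xk.
Qed.

Lemma frac_part_intrD (R : realType) (j : int) (x : R) : 0 <= x < 1 ->
  frac_part (j%:~R + x) = x.
Proof.
move=> x01; rewrite /frac_part (floor_def (m := j)); first by ring.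
by rewrite intrD; move: x01; lra.
Qed.

(** The upper bound on [expR x] comes from [expR (- x) >= 1 - x]. *)
Lemma norm_expR_sub1_le (R : realType) (x : R) : `|x| <= 1 / 2 ->
  `|expR x - 1| <= 2 * `|x|.
Proof.
rewrite ler_norml => /andP[xl xr].
have ge1 := expR_ge1Dx x; have := expR_ge1Dx (- x).
have := expR_gt0 x; rewrite expRN; set e := expR x in ge1 * => e0.
rewrite -(ler_pM2l e0) mulfV ?gt_eqF// => ge2.
have [x0|x0] := leP 0 x.
  rewrite (ger0_norm x0) ger0_norm; last by lra.
  by have : 0 <= (1 - 2 * x) * x by [rewrite mulr_ge0//; lra]; nra.
by rewrite (ltr0_norm x0) ler_norml; apply/andP; split; nra.
Qed.

(** The points [(j + w) / gamma] have spacing [1 / |gamma|], so every closed interval of that length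
    contains one. *)
Lemma exists_intr_window (R : realType) (gamma w P : R) : gamma != 0 ->
  exists j : int, P <= (j%:~R + w) / gamma <= P + `|gamma|^-1.
Proof.
move=> gamma0; have [lt0|gt0] := ltrP gamma 0.
  exists (Num.floor (gamma * P - w)).
  have := floor_itv (gamma * P - w); rewrite intrD ltr0_norm// invrN.
  set j := _%:~R => /andP[j1 j2].
  rewrite (_ : P + - gamma^-1 = (gamma * P - 1) / gamma); last by field.
  by rewrite ler_ndivlMr// ler_nM2r ?invr_lt0//; apply/andP; split; lra.
have {}gt0 : 0 < gamma by rewrite lt_neqAle eq_sym gamma0.
exists (Num.ceil (gamma * P - w)).
have := ceil_itv (gamma * P - w); rewrite intrB gtr0_norm//.
set j := _%:~R => /andP[j1 j2].
rewrite (_ : P + gamma^-1 = (gamma * P + 1) / gamma); last by field.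
by rewrite ler_pdivlMr// ler_pM2r ?invr_gt0//; apply/andP; split; lra.
Qed.

(** * From the first condition to both conditions *)

Section Solutions.
Variables (R : realType) (a kappa : R).
Hypotheses (a_gt0 : 0 < a) (a_lt1 : a < 1).
Local Notation shift := (shift R a kappa).
Local Notation near_integer := (near_integer R a kappa).

(** The integer [k] found at [alpha] serves for all nearby points: on the scale [n^(-alpha) / ln n]
    the first condition barely moves, while [n^x] runs far enough to meet a [T] with [gamma * T]
    congruent to [w] modulo 1. *)
Lemma solutions_porous (c gamma : R) (I : set R) (alpha : R) :
  0 < c -> gamma != 0 -> I° !=set0 -> I `<=` `[0, 1[ -> 1 < alpha ->
  lim_sup_set (near_integer (c / 2)) alpha ->
  exists2 eta : R, 0 < eta & forall (eps : R) (N : nat), 0 < eps ->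
    exists n r y, [/\ (N <= n)%N, 0 < r < eps,
      ball y (eta * r) `<=` [set x | solutions a kappa c gamma I x n]
      & ball y (eta * r) `<=` ball alpha r].
Proof.
move=> c0 gamma0 [w Iw] I01 alpha1 limE.
have L0 : 0 < - ln a by rewrite oppr_gt0 ln_lt0// a_gt0.
have [s [s0 s1 sI]] : exists s : R, [/\ 0 < s, s <= 1 & ball w s `<=` I].
  have [s /= s0 sI] := Iw; exists (Num.min s 1).
  rewrite lt_min s0 ltr01 ge_min lexx orbT; split => // z wz; apply: sI.
  by apply: lt_le_trans wz _; rewrite ge_min lexx.
(* In units of [n^(-alpha) / ln n], [1 / G] bounds the distance from [alpha] to [y] and [sigma] is
   the radius around [y]; the phase then moves by less than [4 * G * sigma = s]. *)
pose G := `|gamma|; have G0 : 0 < G by rewrite normr_gt0.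
pose sigma := s / (4 * G); have sigma0 : 0 < sigma by rewrite divr_gt0 ?mulr_gt0.
pose D := G^-1 + sigma; have D0 : 0 < D by rewrite addr_gt0 ?invr_gt0.
exists (sigma / D); first by rewrite divr_gt0.
move=> eps N eps0.
(* The bounds on [ln n] give [r <= p] and a main term error of [c / 8]; [p <= G] gives [T <= 2 / p].
   Budget: [c / 2 + c / 8 + c / 8 = 3 / 4 * c], as [n^(1-z)] keeps three quarters of
   [n^(1-alpha)]. *)
have [M _ HM] : \forall n \near \oo,
    [/\ [/\ 1 <= ln (n%:R : R), D <= ln (n%:R : R) & 8 * - ln a * D / c <= ln (n%:R : R)],
        n%:R `^ (- alpha) < eps, n%:R `^ (- alpha) < alpha - 1,
        n%:R `^ (- alpha) <= G &
        forall x, `|x - alpha| <= 1 * n%:R `^ (- alpha) ->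
        `|n%:R `^ (1 - x) - n%:R `^ (1 - alpha)|
          <= Num.min (c / 8) (1 / 4) * n%:R `^ (1 - alpha) /\
        `|shift n x - shift n alpha|
          <= Num.min (c / 8) (1 / 4) * n%:R `^ (1 - alpha)].
  have lt_near e : 0 < e -> \forall n \near \oo, n%:R `^ (- alpha) < e.
    move=> e0; have e2 : 0 < e / 2 by lra.
    have := near_natr_powRN _ _ 1 (e / 2) alpha1 e2.
    by apply: filterS => n; rewrite mul1r => /le_lt_trans; apply; lra.
  have le_ln (e : R) : \forall n \near \oo, e <= ln (n%:R : R).
    near=> n; have : expR e <= n%:R by near: n; exact: nbhs_infty_ger.
    move=> en; have n0 := lt_le_trans (expR_gt0 e) en.
    by rewrite -ler_expR lnK// posrE.
  near=> n; split.
  - by split; near: n; exact: le_ln.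
  - by near: n; exact: lt_near.
  - by near: n; apply: lt_near; lra.
  - by apply: ltW; near: n; exact: lt_near.
  - by near: n; apply: near_shift => //; rewrite lt_min !divr_gt0.
have [n /= NMn [n0 _ [k nk]]] := limE (maxn M N) Logic.I.
move: NMn; rewrite geq_max => /andP[Mn Nn].
have [[l1 lD lc] req ralpha rG near_n] := HM n Mn.
have n0' : 0 < n%:R :> R by rewrite ltr0n.
set l := ln n%:R in l1 lD lc *.
have l0 : 0 < l by exact: lt_le_trans l1.
set p := n%:R `^ (- alpha) in req ralpha rG near_n.
have p0 : 0 < p by rewrite powR_gt0.
have pE : n%:R `^ alpha = p^-1 by rewrite /p powRN invrK.
have npE : n%:R `^ (1 - alpha) = n%:R * p by rewrite mulr_natr_powRN.
pose r := D * (p / l).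
have pl0 : 0 < p / l by rewrite divr_gt0.
have r0 : 0 < r by rewrite mulr_gt0.
have rp : r <= p.
  by rewrite /r mulrCA ler_piMr ?(ltW p0)// ler_pdivrMr ?mul1r.
have [j /andP[jT1 jT2]] := exists_intr_window _ gamma w (n%:R `^ alpha) gamma0.
set T := (_ / _) in jT1 jT2.
have T0 : 0 < T by apply: lt_le_trans jT1; rewrite powR_gt0.
have gT : gamma * T = j%:~R + w by rewrite /T mulrC divfK.
clearbody T.
have T2 : T <= 2 * p^-1.
  apply: le_trans jT2 _; rewrite pE -/G.
  have : G^-1 <= p^-1 by rewrite lef_pV2.
  clear - a_gt0 a_lt1; lra.
(* gamma n^y = j + w, hence y is a center of the phase condition. *)
pose y := ln T / l.
have nyE : expR (y * l) = T by rewrite /y divfK ?gt_eqF// lnK.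
have powE z : n%:R `^ z = expR (z * l) by rewrite /powR gt_eqF.
have y_ge : alpha <= y.
  by rewrite /y ler_pdivlMr// -ler_expR -powE lnK.
have y_le : y - alpha <= G^-1 * (p / l).
  (* [(y - alpha) * ln n] equals [ln (T * p)], and [T * p - 1 <= p / G]. *)
  rewrite -(ler_pM2r l0) mulrBl /y divfK ?gt_eqF// mulrA divfK ?gt_eqF//.
  have -> : ln T = alpha * l + ln (T * p).
    by rewrite lnM ?posrE// /p ln_powR -/l; ring.
  have Tp1 : -1 < T * p - 1 by rewrite ltrBrDl subrr mulr_gt0.
  rewrite addrAC subrr add0r (_ : T * p = 1 + (T * p - 1)); last by ring.
  apply: le_trans (le_ln1Dx Tp1) _.
  rewrite lerBlDl; apply: le_trans (_ : (p^-1 + G^-1) * p <= _).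
    by rewrite ler_wpM2r ?(ltW p0)// -pE.
  by rewrite mulrDl mulVf ?gt_eqF.
exists n, r, y.
have etaE : sigma / D * r = sigma * (p / l).
  by rewrite /r; field; rewrite !gt_eqF.
have near_y z : ball y (sigma / D * r) z -> `|z - alpha| < r.
  rewrite etaE /ball/= => yz.
  rewrite (_ : z - alpha = (y - alpha) + (z - y)); last by ring.
  apply: le_lt_trans (ler_normD _ _) _; rewrite /r /D mulrDl ler_ltD 1?distrC//.
  by rewrite distrC ger0_norm// subr_ge0.
split => //; first by rewrite r0 (le_lt_trans rp).
- move=> z yz /=; have za := near_y _ yz.
  have zp : `|z - alpha| <= 1 * p by rewrite mul1r (le_trans (ltW za)).
  have [nz sz] := near_n z zp.
  have z1 : 1 < z.
    move: za ralpha rp; rewrite ltr_norml => /andP[].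
    clear - a_gt0 a_lt1; lra.
  split => //.
  + apply: le_trans (dist_int_le _ _ k) _.
    rewrite -/(shift n z) -powRN opprB.
    have minle8 : Num.min (c / 8) (1 / 4) * n%:R `^ (1 - alpha) <= c / 8 * (n%:R * p).
      by rewrite npE ler_wpM2r ?ge_min ?lexx// mulr_ge0 ?ltW.
    have minle4 : Num.min (c / 8) (1 / 4) * n%:R `^ (1 - alpha) <= 1 / 4 * (n%:R * p).
      by rewrite npE ler_wpM2r ?ge_min ?lexx ?orbT// mulr_ge0 ?ltW.
    have lip : `|a `^ (1 / z) - a `^ (1 / alpha)| <= - ln a * r.
      apply: le_trans (powR_inv_lipschitz _ _ a_gt0 a_lt1 _ _ (ltW alpha1) (ltW z1)) _.
      by rewrite ler_pM2l// ltW.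
    have -> : n%:R * a `^ (1 / z) + shift n z - k%:~R =
        n%:R * (a `^ (1 / z) - a `^ (1 / alpha)) + (shift n z - shift n alpha)
        + (n%:R * a `^ (1 / alpha) + shift n alpha - k%:~R) by ring.
    have lip' : n%:R * `|a `^ (1 / z) - a `^ (1 / alpha)| <= c / 8 * (n%:R * p).
      apply: le_trans (_ : n%:R * (- ln a * r) <= _); first by rewrite ler_pM2l.
      have -> : n%:R * (- ln a * r) = n%:R * p * (- ln a * D / l).
        by rewrite /r; field; rewrite gt_eqF.
      rewrite [leRHS]mulrC ler_wpM2l ?mulr_ge0 ?(ltW n0') ?(ltW p0)//.
      move: lc; rewrite !ler_pdivrMr//; clear - a_gt0 a_lt1; lra.
    have cnp0 : 0 <= c * (n%:R * p) by rewrite !mulr_ge0 ?ltW.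
    have : 3 / 4 * (n%:R * p) <= n%:R `^ (1 - z).
      move: (le_trans nz minle4); rewrite npE ler_norml => /andP[].
      clear - a_gt0 a_lt1; lra.
    move=> /(ler_wpM2l (ltW c0)); apply: le_trans.
    apply: le_trans (ler_normD _ _) _.
    apply: le_trans (lerD (ler_normD _ _) (lexx _)) _.
    rewrite normrM (gtr0_norm n0') -addrA.
    move: nk; rewrite npE; move: lip' (le_trans sz minle8) cnp0.
    clear - a_gt0 a_lt1; lra.
  + have zE : n%:R `^ z = T * expR ((z - y) * l).
      by rewrite powE -nyE -expRD; congr expR; ring.
    have zyl : `|(z - y) * l| < sigma * p.
      move: yz; rewrite etaE /ball/= distrC => yz.
      rewrite normrM (gtr0_norm l0) -ltr_pdivlMr// -mulrA; exact: yz.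
    have sigmap : sigma * p <= s / 4.
      rewrite /sigma invfM mulrA -mulrA ler_piMr ?divr_ge0 ?(ltW s0)//.
      by rewrite mulrC ler_pdivrMr// mul1r.
    have half : `|(z - y) * l| <= 1 / 2.
      by move: zyl sigmap s1; clear - a_gt0 a_lt1; lra.
    pose d := gamma * n%:R `^ z - gamma * T.
    have ds : `|d| < s.
      rewrite /d zE -mulrBr -[X in _ - X]mulr1 -mulrBr !normrM (gtr0_norm T0) -/G.
      have := norm_expR_sub1_le _ _ half; set e := `|expR _ - 1| => e2.
      apply: le_lt_trans (_ : G * (2 * p^-1 * e) < _).
        by rewrite ler_pM2l// ler_wpM2r ?normr_ge0.
      have -> : s = G * (2 * p^-1 * (2 * (sigma * p))).
        by rewrite /sigma; field; rewrite !gt_eqF.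
      rewrite ltr_pM2l// ltr_pM2l ?mulr_gt0 ?invr_gt0//.
      by apply: le_lt_trans e2 _; rewrite ltr_pM2l.
    have -> : gamma * n%:R `^ z = j%:~R + (w + d) by rewrite addrA -gT /d; ring.
    have Iwd : I (w + d).
      by apply: sI; rewrite /ball/= opprD addrA subrr add0r normrN.
    rewrite frac_part_intrD//.
    by have := I01 _ Iwd; rewrite /= in_itv.
- by move=> z /near_y; rewrite /ball/= distrC.
Unshelve. all: by end_near. Qed.

End Solutions.


(** * Finitely many solutions *)

(** Comparison with the integral of [x^(-1-t)], by telescoping; the term at 0 vanishes. *)
Lemma sum_natr_powRN_le (R : realType) (t : R) (n : nat) : 0 < t ->
  \sum_(i < n.+2) i%:R `^ (- (1 + t)) <= 1 + t^-1 - n.+1%:R `^ (- t) / t.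
Proof.
move=> t0; elim: n => [|n IH].
  rewrite !big_ord_recl big_ord0 powR0 ?oppr_eq0 ?gt_eqF ?addr_gt0//= !powR1.
  by rewrite mul1r add0r addr0 addrK.
rewrite big_ord_recr/=; apply: le_trans (lerD IH (lexx _)) _.
rewrite -addrA lerD2l addrC lerBlDr [leRHS]addrC -mulrBl ler_pdivlMr//.
have N0 : 0 < n.+1%:R :> R by rewrite ltr0n.
have M0 : 0 < n.+2%:R :> R by rewrite ltr0n.
have -> : n.+1%:R `^ (- t) = n.+2%:R `^ (- t) * expR (- (t * ln (n.+1%:R / n.+2%:R))).
  by rewrite /powR !gt_eqF// -expRD ln_div ?posrE//; congr expR; ring.
have -> : n.+2%:R `^ (- (1 + t)) = n.+2%:R `^ (- t) / n.+2%:R.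
  by rewrite opprD addrC powRD ?powR_inv1 ?ler0n// pnatr_eq0 implybT.
rewrite -mulrA -[X in _ <= _ - X]mulr1 -mulrBr ler_wpM2l ?powR_ge0//.
rewrite lerBrDl; apply: le_trans (expR_ge1Dx _); rewrite lerD2l.
rewrite mulrC -mulrN ler_pM2l// lerNr.
have -> : n.+1%:R / n.+2%:R = 1 + - n.+2%:R^-1 :> R.
  by rewrite -[X in X / _](addrK 1) natr1 mulrBl mulfV ?gt_eqF// div1r.
by apply: le_ln1Dx; rewrite ltrN2 invf_lt1// ltr1n.
Qed.

Lemma nneseries_natr_powRN_lty (R : realType) (q C : R) : 1 < q -> 0 <= C ->
  (\sum_(n <oo) (C * n%:R `^ (- q))%:E < +oo)%E.
Proof.
move=> q1 C0; have t0 : 0 < q - 1 by lra.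
have u0 n : (0 <= (C * n%:R `^ (- q))%:E)%E by rewrite lee_fin mulr_ge0 ?powR_ge0.
apply: (@le_lt_trans _ _ (C * (1 + (q - 1)^-1))%:E); last exact: ltry.
apply: lime_le; first by apply: is_cvg_nneseries.
exists 2%N => // -[|[|n]] //= _.
rewrite big_mkord sumEFin lee_fin -mulr_sumr ler_wpM2l//.
have := sum_natr_powRN_le _ _ n t0; rewrite addrC subrK => /le_trans; apply.
by rewrite gerBl divr_ge0 ?powR_ge0// ltW.
Qed.

Lemma not_lim_sup_finite (T : Type) (S : nat -> set T) (x : T) :
  ~ lim_sup_set S x -> finite_set [set n | S n x].
Proof.
move=> nSx; have [N HN] : exists N, forall n, (N <= n)%N -> ~ S n x.
  apply: contrapT => H; apply: nSx => N _; apply: contrapT => nS; apply: H.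
  by exists N => n Nn Sn; apply: nS; exists n.
apply: sub_finite_set (finite_II N) => n /= Sn.
by rewrite ltnNge; apply/negP => /HN.
Qed.

Lemma lim_sup_infinite (T : Type) (S : nat -> set T) (x : T) :
  lim_sup_set S x -> infinite_set [set n | S n x].
Proof.
move=> limS /finite_seqP [s sE].
have [n /= Nn Sn] := limS (\max_(i <- s) i).+1 Logic.I.
have : n \in s by have : [set n | S n x] n by []; rewrite sE.
by move=> ns; have := @leq_bigmax_seq _ s predT id n ns isT; rewrite leqNgt Nn.
Qed.

Section Finiteness.
Variables (R : realType) (a kappa c gamma : R) (I : set R).
Hypotheses (a_gt0 : 0 < a) (a_lt1 : a < 1) (c_gt0 : 0 < c).
Local Notation mu := (@lebesgue_measure R).
Local Notation sol := (solutions a kappa c gamma I).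

Lemma solutions_near_integer (s alpha : R) (n : nat) : 1 <= s -> s <= alpha ->
  sol alpha n -> exists k : int,
    `|n%:R * a `^ (1 / alpha) - k%:~R| <= (2 * c + `|kappa|) * n%:R `^ (1 - s).
Proof.
move=> s1 salpha [n0 dn _]; have alpha1 : 1 <= alpha by exact: le_trans salpha.
have p0 : 0 < n%:R `^ (1 - alpha) by rewrite powR_gt0 ?ltr0n.
(* Doubling [c] makes the bound strict, so that some integer [k] realises it. *)
have : dist_int (n%:R * a `^ (1 / alpha) + shift _ a kappa n alpha)
    < 2 * c * n%:R `^ (1 - alpha).
  apply: le_lt_trans dn _; rewrite -powRN opprB.
  by rewrite ltr_pM2r//; move: c_gt0; lra.
move=> /dist_int_lt [k nk]; exists k.
apply: (@le_trans _ _ ((2 * c + `|kappa|) * n%:R `^ (1 - alpha))); last first.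
  rewrite ler_wpM2l ?addr_ge0 ?mulr_ge0 ?(ltW c_gt0)// ler_powR ?ler1n//.
  by move: salpha; clear - a_gt0 a_lt1 c_gt0; lra.
have := norm_shift_le _ _ kappa a_gt0 a_lt1 n alpha alpha1.
move=> sh; rewrite (_ : _ - _ = (n%:R * a `^ (1 / alpha) + shift _ a kappa n alpha - k%:~R)
  - shift _ a kappa n alpha); last by ring.
by apply: le_trans (ler_normB _ _) _; rewrite mulrDl lerD// ltW.
Qed.

(** The lower end [s] gives a uniform summable exponent, and [M] gives a uniform lower slope [m]. *)
Lemma infinite_solutions_negligible (s M : R) : 2 < s ->
  mu.-negligible [set alpha | s <= alpha <= M /\ ~ finite_set (sol alpha)].
Proof.
move=> s2; have s1 : 1 < s by lra.
have L0 : 0 < - ln a by rewrite oppr_gt0 ln_lt0// a_gt0.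
have [Ms|sM] := ltP M s.
  apply: negligibleS (negligible_set0 _) => x [/andP[sx xM] _].
  by have := lt_le_trans Ms (le_trans sx xM); rewrite ltxx.
have M0 : 0 < M by lra.
pose m := a * - ln a / M ^+ 2.
have m0 : 0 < m by rewrite divr_gt0 ?mulr_gt0 ?exprn_gt0.
pose K := 2 * c + `|kappa|; have K0 : 0 < K by rewrite ltr_pwDl// mulr_gt0.
(* Since [0 <= n * a^(1/x) <= n] and the error is at most [K], the nearby integer lies between [-J]
   and [n + J]. *)
pose J := (Num.truncn K).+1.
have KJ : K <= J%:R by rewrite ltW// truncnS_gt.
(* The integer near n h(x) is written i - J to be indexed by a natural number. *)
pose D n (i : nat) := [set x : R | s <= x <= M /\
  `|n%:R * a `^ (1 / x) - (i%:R - J%:R)| <= K * n%:R `^ (1 - s)].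
(* Two points of [D n i] are at distance at most [2 * K / m * n^(-s)]; the factor 3 makes this
   strict for the open ball. *)
pose rad n := 3 * K / m * n%:R `^ (- s).
have rad0 n : 0 <= rad n.
  apply: mulr_ge0; last exact: powR_ge0.
  by apply: divr_ge0; [apply: mulr_ge0 => //; exact: ltW|exact: ltW].
(* Each centre is an arbitrary point of [D n i], or 0 when that set is empty. *)
pose C n : set R := \big[setU/set0]_(i < (n + 2 * J).+1) ball (xget 0 (D n i)) (rad n).
have DC n i x : (0 < n)%N -> D n i x -> ball (xget 0 (D n i)) (rad n) x.
  move=> n0 Dx; have n0' : 0 < n%:R :> R by rewrite ltr0n.
  have : D n i (xget 0 (D n i)) by apply: (xgetI _ Dx).
  move: (xget _ _) => y [/andP[sy yM] Dy].
  move: Dx => [/andP[sx xM] Dx].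
  have gap u v : s <= u -> u <= v -> v <= M ->
      m * `|v - u| <= `|a `^ (1 / v) - a `^ (1 / u)|.
    move=> su uv vM; rewrite ger0_norm ?subr_ge0//.
    apply: le_trans (ler_norm _); apply: powR_inv_increment_ge => //.
    by apply: le_trans su; exact: ltW.
  have {}gap : m * `|y - x| <= `|a `^ (1 / y) - a `^ (1 / x)|.
    have [xy|/ltW yx] := leP x y; first exact: gap.
    by rewrite distrC (distrC (_ `^ _)); exact: gap.
  rewrite /ball/= -(ltr_pM2l m0); apply: le_lt_trans gap _.
  rewrite -(ltr_pM2l n0') -[X in X * `|_|](gtr0_norm n0') -normrM.
  rewrite (_ : n%:R * _ = (n%:R * a `^ (1 / y) - (i%:R - J%:R))
    - (n%:R * a `^ (1 / x) - (i%:R - J%:R))); last by ring.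
  apply: le_lt_trans (ler_normB _ _) _.
  apply: le_lt_trans (lerD Dy Dx) _.
  rewrite -mulr_natr_powRN// /rad.
  have -> : n%:R * (m * (3 * K / m * n%:R `^ (- s))) = 3 * (K * (n%:R * n%:R `^ (- s))).
    by field; rewrite gt_eqF.
  have : 0 < K * (n%:R * n%:R `^ (- s)) by rewrite !mulr_gt0// powR_gt0.
  by clear - a_gt0 a_lt1 c_gt0; lra.
have mC n : measurable (C n).
  by apply: bigsetU_measurable => i _; exact: measurable_ball.
(* For [n >= 1] the number [n + 2 * J + 1] of balls is at most [(2 * J + 2) * n]; for [n = 0] both
   sides are 0. *)
have muC n : (mu (C n) <= ((2 * J + 2)%:R * 6 * K / m * n%:R `^ (- (s - 1)))%:E)%E.
  apply: (le_trans (@Boole_inequality _ _ _ mu (fun i => ball (xget 0 (D n i)) (rad n)) _ _)).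
    by move=> i _; exact: measurable_ball.
  rewrite (eq_bigr (fun=> (rad n *+ 2)%:E)); last first.
    by move=> i _; exact: lebesgue_measure_ball.
  rewrite sumEFin sumr_const card_ord lee_fin.
  have [->|n0] := posnP n.
    rewrite /rad powR0 ?mulr0 ?mul0rn; last by rewrite oppr_eq0 gt_eqF//; lra.
    by rewrite powR0 ?mulr0// oppr_eq0 gt_eqF//; lra.
  rewrite opprB -mulr_natr_powRN// -mulrnA -[leLHS]mulr_natr natrM.
  have := rad0 n; rewrite /rad; set p := n%:R `^ _ => radn.
  rewrite (_ : _ * 6 * K / m * (n%:R * p) =
    3 * K / m * p * (2 * ((2 * J + 2)%:R * n%:R))); last by ring.
  rewrite ler_wpM2l// ler_pM2l// -natrM ler_nat; nia.
have limC : mu (lim_sup_set C) = 0%E.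
  apply: lim_sup_set_cvg0 => //.
  have : (\sum_(n <oo) ((2 * J + 2)%:R * 6 * K / m * n%:R `^ (- (s - 1)))%:E < +oo)%E.
    apply: nneseries_natr_powRN_lty; first by lra.
    apply: divr_ge0; last exact: ltW.
    by apply: mulr_ge0; [rewrite mulr_ge0|exact: ltW].
  by apply: le_lt_trans; apply: lee_nneseries => // n _; exact: muC.
exists (lim_sup_set C); split => //.
  by apply: bigcap_measurable => // n _; apply: bigcup_measurable => k _; exact: mC.
move=> x [/andP[sx xM] infx]; apply: contrapT => nCx; apply: infx.
apply: sub_finite_set (not_lim_sup_finite _ _ _ nCx) => n /= soln.
have x1 : 1 <= x by apply: le_trans sx; exact: ltW.
have n0 : (0 < n)%N by case: soln.
have [k nk] := solutions_near_integer _ _ _ (ltW s1) sx soln.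
have n0' : 0 < n%:R :> R by rewrite ltr0n.
have bnd : `|n%:R * a `^ (1 / x) - k%:~R| <= J%:R.
  apply: le_trans nk _; apply: le_trans KJ; rewrite -/K ler_piMr ?(ltW K0)//.
  by rewrite -[leRHS](powRr0 n%:R) ler_powR ?ler1n//; lra.
have h0 : 0 <= n%:R * a `^ (1 / x) by rewrite mulr_ge0 ?powR_ge0.
have h1 : n%:R * a `^ (1 / x) <= n%:R.
  by rewrite ler_piMr// powR_inv_le1//; lra.
move: bnd; rewrite ler_norml => /andP[b1 b2].
have kJ : 0 <= k + J%:Z.
  by rewrite -(ler0z R) intrD; lra.
have kn : k + J%:Z <= (n + 2 * J)%:Z.
  by rewrite -(ler_int R) intrD -[X in _ <= X]/((n + 2 * J)%:R) natrD natrM; lra.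
have [i iE] : exists i : nat, k + J%:Z = i by case: (k + _) kJ => // i _; exists i.
have i_lt : (i < (n + 2 * J).+1)%N by move: kn; rewrite iE.
have kE : k%:~R = i%:R - J%:R :> R.
  by rewrite -[k](addrK J%:Z) iE intrB.
rewrite /C -(bigcup_mkord _ (fun i => ball (xget 0 (D n i)) (rad n))); exists i => //.
by apply: DC => //; split; [rewrite sx|rewrite -kE].
Qed.

End Finiteness.

Theorem theorem4p1 (R : realType) (a : R) (I : set R) (kappa c gamma : R) :
  0 < a -> a < 1 ->
  is_interval I -> I° !=set0 -> I `<=` `[0, 1[ ->
  0 < c -> gamma != 0 ->
  {ae @lebesgue_measure R, forall alpha : R, 1 < alpha ->
    (alpha < 2 -> infinite_set (solutions a kappa c gamma I alpha)) /\
    (2 < alpha -> finite_set (solutions a kappa c gamma I alpha))}.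
Proof.
move=> a0 a1 _ I0 I01 c0 gamma0.
(* The first stage uses [c / 2], leaving room to move around [alpha] in the second. *)
pose near := near_integer R a kappa (c / 2).
pose sol n := [set x | solutions a kappa c gamma I x n].
(* These compact intervals exhaust []2, +oo[]. *)
pose many j := [set alpha : R | 2 + j.+1%:R^-1 <= alpha <= j%:R
  /\ ~ finite_set (solutions a kappa c gamma I alpha)].
have neg_near : (@lebesgue_measure R).-negligible (`]1, 2[ `\` lim_sup_set near).
  apply: porous_limsup_negligible => x; rewrite /= in_itv/= => /andP[x1 x2].
  by apply: near_integer_porous => //; rewrite divr_gt0.
have neg_sol : (@lebesgue_measure R).-negligible
    ((`]1, 2[ `&` lim_sup_set near) `\` lim_sup_set sol).
  apply: porous_limsup_negligible => x [+ nearx]; rewrite /= in_itv/= => /andP[x1 _].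
  exact: solutions_porous.
have neg_many : (@lebesgue_measure R).-negligible (\bigcup_j many j).
  apply: negligible_bigcup => j; apply: infinite_solutions_negligible => //.
  by rewrite ltrDl invr_gt0.
apply: negligibleS (negligibleU neg_many (negligibleU neg_near neg_sol)).
move=> x /= /not_implyP [x1]; apply: contra_notP => /not_orP[nmany /not_orP[nnear nsol]].
split=> x2.
  have x12 : `]1, 2[%classic x by rewrite /= in_itv/= x1.
  apply: (lim_sup_infinite _ sol x); apply: contrapT => nlim; apply: nsol; split => //.
  by split => //; apply: contrapT => nnearx; apply: nnear.
apply: contrapT => infx; apply: nmany.
pose j := (Num.truncn (Num.max x (x - 2)^-1)).+1; exists j => //; split => //.
have := truncnS_gt (Num.max x (x - 2)^-1); rewrite -/j gt_max => /andP[xj x2j].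
have x20 : 0 < x - 2 by rewrite subr_gt0.
rewrite (ltW xj) andbT addrC -lerBrDr -[leRHS]invrK lef_pV2 ?posrE ?invr_gt0//.
by apply: le_trans (ltW x2j) _; rewrite ler_nat.
Qed.
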